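(* Let $\mathcal{F}=((X,d),(f_i)_{i\in I})$ be a generalized possibly infinite iterated function system of order $m\in\mathbb{N}^*$ such that $\sup_{i\in I}\mathrm{lip}(f_i)<1$. Then the operator $H_{\mathcal{F}}:\mathcal{C}^m\to\mathcal{C}$ is Meir-Keeler.
   Context: $\mathbb{N}^{*}=\{1,2,\dots\}$. The sets $X$ and $I$ are nonempty. For a metric space $(Y,\rho)$ and $m\in\mathbb{N}^*$, $Y^m$ carries the maximum metric $\rho_{\max}((x_1,\dots,x_m),(y_1,\dots,y_m))=\max_j \rho(x_j,y_j)$. For a map $f:Y^m\to Y$, $\mathrm{lip}(f)\in[0,\infty]$ denotes its least Lipschitz constant with respect to $\rho_{\max}$ and $\rho$; $f$ is Meir-Keeler if for every $\varepsilon>0$ there is $\delta_\varepsilon>0$ such that $\rho(f(x),f(y))<\varepsilon$ for all $x,y\in Y^m$ with $\rho_{\max}(x,y)<\varepsilon+\delta_\varepsilon$. A generalized possibly infinite iterated function system of order $m$ is a pair $\mathcal{F}=((X,d),(f_i)_{i\in I})$, where $(X,d)$ is a metric space, each $f_i:X^m\to X$ is continuous, and the family $(f_i)_{i\in I}$ is bounded, i.e. $\bigcup_{i\in I}f_i(B)$ is bounded for every bounded $B\subseteq X^m$. Code space: $\Omega_1=I$, $\Omega_{k+1}=\Omega_k\times\dots\times\Omega_k$ ($m$ times), and $\Omega=\Omega_1\times\Omega_2\times\cdots$. Elements of $\Omega$ are written $\alpha=\alpha^1\alpha^2\dots\alpha^k\dots$ with $\alpha^k\in\Omega_k$; for $k\ge2$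 write $\alpha^k=\alpha^k_1\alpha^k_2\dots\alpha^k_m$ with $\alpha^k_i\in\Omega_{k-1}$, and for $i\in\{1,\dots,m\}$ put $\alpha(i)=\alpha^2_i\alpha^3_i\alpha^4_i\dots\in\Omega$. $\Omega$ is endowed with the metric $d(\alpha,\beta)=\sum_{k\ge1}c^k\,\delta(\alpha^k,\beta^k)$, where $c\in(0,1)$ is fixed and $\delta(\alpha^k,\beta^k)$ is $1$ if $\alpha^k\neq\beta^k$ and $0$ otherwise. $\mathcal{C}$ is the set of continuous bounded functions $f:\Omega\to X$ with the metric $d_u(f,g)=\sup_{\alpha\in\Omega}d(f(\alpha),g(\alpha))$; $\mathcal{C}^m$ carries the corresponding maximum metric. The operator $H_{\mathcal{F}}:\mathcal{C}^m\to\mathcal{C}$ is $H_{\mathcal{F}}(g_1,\dots,g_m)(\alpha)=f_{\alpha^1}(g_1(\alpha(1)),\dots,g_m(\alpha(m)))$ for $\alpha=\alpha^1\alpha^2\dots\in\Omega$. *)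

(* Defs.v *)
From HB Require Import structures.
From mathcomp Require Import all_boot all_order all_algebra.
From mathcomp Require Import all_classical all_reals all_analysis.

Set Implicit Arguments.
Unset Strict Implicit.
Unset Printing Implicit Defensive.

Import Order.TTheory GRing.Theory Num.Theory.
Import numFieldNormedType.Exports.
Import metricType_numDomainType.

Local Open Scope classical_set_scope.
Local Open Scope ring_scope.

Lemma continuous_mdistP {R : realType} (T X : metricType R) (f : T -> X) :
  continuous f <-> forall a e, 0 < e ->
    exists2 d, 0 < d & forall b, mdist a b < d -> mdist (f a) (f b) < e.
Proof.
split=> [fc a e e0|h a].
  have /cvgrPdist_lt /(_ _ e0) := fc a.
  by move=> /nbhs_mdistP[d d0 hd]; exists d => // b; exact: hd.
apply/cvgrPdist_lt => e e0; have [d d0 hd] := h a _ e0.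
by apply/nbhs_mdistP; exists d.
Qed.

Definition mpow (Y : Type) (m : nat) : Type := {ffun 'I_m -> Y}.

HB.instance Definition _ (Y : choiceType) (m : nat) :=
  Choice.copy (mpow Y m) {ffun 'I_m -> Y}.

Section MaxMetric.
Context {R : realType} {Y : metricType R} {m : nat}.
Implicit Types x y z : mpow Y m.

(* Distances are nonnegative, so starting the maximum at 0 changes nothing
   when 0 < m. *)
Definition max_dist x y : R :=
  \big[Num.max/0]_(j < m) mdist (x j : Y) (y j).

Lemma max_dist_ge x y j : mdist (x j : Y) (y j) <= max_dist x y.
Proof. exact: (le_bigmax _ (fun j => mdist (x j : Y) (y j))). Qed.

Lemma max_dist_le x y e : 0 <= e ->
  (forall j, mdist (x j : Y) (y j) <= e) -> max_dist x y <= e.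
Proof. by move=> e0 h; apply: bigmax_le => // i _; exact: h. Qed.

Lemma max_dist_ge0 x y : 0 <= max_dist x y.
Proof. exact: bigmax_ge_id. Qed.

Lemma max_distxx x : max_dist x x = 0.
Proof.
apply/eqP; rewrite eq_le max_dist_ge0 andbT.
by apply: max_dist_le => // j; rewrite mdistxx.
Qed.

Lemma max_dist_positivity x y : max_dist x y = 0 -> x = y.
Proof.
move=> xy0; apply/ffunP => j; apply: (@mdist_positivity R Y).
by apply/eqP; rewrite eq_le mdist_ge0 andbT -xy0 max_dist_ge.
Qed.

Lemma max_dist_sym x y : max_dist x y = max_dist y x.
Proof. by apply: eq_bigr => j _; exact: metric_sym. Qed.

Lemma max_dist_triangle y x z : max_dist x z <= max_dist x y + max_dist y z.
Proof.
apply: max_dist_le; first by rewrite addr_ge0 // max_dist_ge0.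
move=> j; apply: le_trans (metric_triangle _ (y j : Y) _) _.
by rewrite lerD // max_dist_ge.
Qed.

HB.instance Definition _ := isMetric.Build R (mpow Y m)
  max_distxx max_dist_positivity max_dist_sym max_dist_triangle.

End MaxMetric.

Section MetricNotions.
Context {R : realType}.

Definition metric_bounded (Y : metricType R) (A : set Y) : Prop :=
  exists M : R, forall x y : Y, A x -> A y -> mdist x y <= M.

(* +oo when f is not Lipschitz, the infimum of the empty set being +oo. *)
Definition lip (Y Z : metricType R) (f : Y -> Z) : \bar R :=
  ereal_inf [set L%:E | L in
    [set L : R | 0 <= L /\ forall x y, mdist (f x) (f y) <= L * mdist x y]].

Definition meir_keeler (Y : metricType R) (m : nat) (f : mpow Y m -> Y) : Prop :=
  forall e : R, 0 < e -> exists2 delta : R, 0 < delta &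
    forall x y : mpow Y m, mdist x y < e + delta -> mdist (f x) (f y) < e.

Record gifs (X : metricType R) (I : Type) (m : nat) := Gifs {
  gifs_map :> I -> mpow X m -> X ;
  gifs_continuous : forall i, continuous (gifs_map i) ;
  gifs_bounded : forall B : set (mpow X m), metric_bounded B ->
    metric_bounded (\bigcup_(i in [set: I]) (gifs_map i @` B)) }.

End MetricNotions.

(* Levels are numbered from 0: code m I k is Omega_(k+1), and the coordinate
   alpha k of alpha : Omega below is alpha^(k+1). *)
Fixpoint code (m : nat) (I : Type) (k : nat) : Type :=
  if k is k'.+1 then mpow (code m I k') m else I.

(* c and its bounds are parameters of the type only because they determine its
   metric. *)
Definition Omega (R : realType) (c : R) (hc : 0 < c < 1) (m : nat) (I : Type)
  : Type := forall k : nat, code m I k.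

Section CodeSpace.
Context {R : realType} {c : R} {hc : 0 < c < 1} {m : nat} {I : Type}.
Local Notation Om := (Omega hc m I).
Implicit Types a b : Om.

(* alpha(j): component j of alpha^(k+2), an element of Omega_(k+1), for each k. *)
Definition shift a (j : 'I_m) : Om := fun k => (a k.+1 : mpow (code m I k) m) j.

Definition Omega_term a b (k : nat) : R := c ^+ k.+1 * (`[< a k <> b k >])%:R.

Definition Omega_dist a b : R := limn (series (Omega_term a b)).

Lemma c_gt0 : 0 < c. Proof. by case/andP: hc. Qed.

Lemma Omega_term_ge0 a b k : 0 <= Omega_term a b k.
Proof. by rewrite mulr_ge0 // ?ler0n // exprn_ge0 // ltW // c_gt0. Qed.

Lemma Omega_term_le a b k : Omega_term a b k <= geometric c c k.
Proof.
rewrite /Omega_term /geometric /= exprS ler_piMr // ?lern1 ?leq_b1 //.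
by rewrite mulr_ge0 // ?exprn_ge0 // ltW // c_gt0.
Qed.

Lemma Omega_dist_cvg a b : cvgn (series (Omega_term a b)).
Proof.
have cs : cvgn (series (geometric c c)).
  by apply: is_cvg_geometric_series; rewrite gtr0_norm ?c_gt0 //; case/andP: hc.
apply: series_le_cvg cs; [exact: Omega_term_ge0| |exact: Omega_term_le].
by move=> k; rewrite (le_trans (Omega_term_ge0 a b k)) // Omega_term_le.
Qed.

Lemma Omega_dist_ge_series a b n : series (Omega_term a b) n <= Omega_dist a b.
Proof.
apply: nondecreasing_cvgn_le; last exact: Omega_dist_cvg.
by apply: nondecreasing_series => k _ _; exact: Omega_term_ge0.
Qed.

Lemma Omega_dist_ge_term a b k : Omega_term a b k <= Omega_dist a b.
Proof.
apply: le_trans (Omega_dist_ge_series a b k.+1).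
rewrite /series /= big_nat_recr //= lerDr sumr_ge0 // => i _.
exact: Omega_term_ge0.
Qed.

Lemma Omega_dist_le a b M :
  (forall n, series (Omega_term a b) n <= M) -> Omega_dist a b <= M.
Proof.
move=> h; apply: limr_le; first exact: Omega_dist_cvg.
exact: nearW.
Qed.

Lemma Omega_dist_lt_eq a b k : Omega_dist a b < c ^+ k.+1 -> a k = b k.
Proof.
move=> d; apply: contrapT => ne; move: d; apply/negP; rewrite -leNgt.
by apply: le_trans (Omega_dist_ge_term a b k); rewrite /Omega_term asboolT ?mulr1.
Qed.

Lemma Omega_distxx a : Omega_dist a a = 0.
Proof.
apply/eqP; rewrite eq_le; apply/andP; split; last first.
  by apply: le_trans (Omega_dist_ge_term a a 0%N); exact: Omega_term_ge0.
apply: Omega_dist_le => n; rewrite /series /= big1 // => k _.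
by rewrite /Omega_term asboolF ?mulr0.
Qed.

Lemma Omega_dist_positivity a b : Omega_dist a b = 0 -> a = b.
Proof.
move=> d0; apply: functional_extensionality_dep => k.
by apply: Omega_dist_lt_eq; rewrite d0 exprn_gt0 // c_gt0.
Qed.

Lemma Omega_dist_sym a b : Omega_dist a b = Omega_dist b a.
Proof.
rewrite /Omega_dist; congr (limn (series _)); apply/funext => k.
rewrite /Omega_term; congr (_ * (nat_of_bool _)%:R).
by apply: asbool_equiv_eq; split=> + /esym.
Qed.

Lemma Omega_dist_triangle b a d :
  Omega_dist a d <= Omega_dist a b + Omega_dist b d.
Proof.
apply: Omega_dist_le => n.
apply: (@le_trans _ _ (series (Omega_term a b) n + series (Omega_term b d) n));
  last by rewrite lerD // Omega_dist_ge_series.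
rewrite /series /= -big_split /=; apply: ler_sum => k _.
rewrite /Omega_term -mulrDr ler_wpM2l ?exprn_ge0 ?(ltW c_gt0) //.
have [ab|ab] := pselect (a k = b k); last first.
  by rewrite (asboolT ab) -natrD ler_nat (leq_trans (leq_b1 _)).
by rewrite ab lerDr ler0n.
Qed.

HB.instance Definition _ := gen_eqMixin Om.
HB.instance Definition _ := gen_choiceMixin Om.
HB.instance Definition _ := isMetric.Build R Om
  Omega_distxx Omega_dist_positivity Omega_dist_sym Omega_dist_triangle.

Lemma shift_lipschitz (a b : Om) j :
  mdist (shift a j) (shift b j) <= c^-1 * mdist a b.
Proof.
apply: Omega_dist_le => n; rewrite mulrC ler_pdivlMr ?c_gt0 //.
apply: le_trans (Omega_dist_ge_series a b n.+1).
rewrite /series /= big_nat_recl //= mulr_suml.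
apply: (@le_trans _ _ (\sum_(0 <= k < n) Omega_term a b k.+1)); last first.
  by rewrite lerDr Omega_term_ge0.
apply: ler_sum => k _; rewrite /Omega_term mulrAC -exprSr.
rewrite ler_wpM2l ?exprn_ge0 ?(ltW c_gt0) // ler_nat.
have [ab|ab] := pselect (a k.+1 = b k.+1); last by rewrite (asboolT ab) leq_b1.
by rewrite asboolF //; apply; rewrite /shift ab.
Qed.

Lemma shift_continuous j : continuous (fun a : Om => shift a j).
Proof.
apply/continuous_mdistP => a e e0.
exists (c * e); first by rewrite mulr_gt0 // c_gt0.
move=> b ab; apply: le_lt_trans (shift_lipschitz a b j) _.
by rewrite mulrC ltr_pdivrMr ?c_gt0 // mulrC.
Qed.

End CodeSpace.

Section FunctionSpace.
Context {R : realType}.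

Record cbfun (T X : metricType R) := Cbfun {
  cbfun_map :> T -> X ;
  cbfun_continuous : continuous cbfun_map ;
  cbfun_bounded : metric_bounded (range cbfun_map) }.

Context {T X : metricType R}.
Implicit Types f g h : cbfun T X.

Definition unif_dist f g : R := sup (range (fun a => mdist (f a) (g a))).

Lemma unif_dist_has_ubound f g :
  has_ubound (range (fun a => mdist (f a) (g a))).
Proof.
have [[a0 _]|] := pselect (exists a0 : T, True); last first.
  by move=> nT; exists 0 => x [a _ _]; case: nT; exists a.
have [M hM] := cbfun_bounded f; have [N hN] := cbfun_bounded g.
exists (M + (mdist (f a0) (g a0) + N)) => _ [a _ <-].
apply: le_trans (metric_triangle _ (f a0) _) _; rewrite lerD //.
  by apply: hM; [exists a|exists a0].
apply: le_trans (metric_triangle _ (g a0) _) _; rewrite lerD //.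
by apply: hN; [exists a0|exists a].
Qed.

Lemma unif_dist_ge f g a : mdist (f a) (g a) <= unif_dist f g.
Proof. by apply: ub_le_sup; [exact: unif_dist_has_ubound|exists a]. Qed.

Lemma unif_dist_le f g e : 0 <= e ->
  (forall a, mdist (f a) (g a) <= e) -> unif_dist f g <= e.
Proof.
move=> e0 hfg; rewrite /unif_dist.
have [r0|/set0P ne] := eqVneq (range (fun a => mdist (f a) (g a))) set0.
  by rewrite r0 sup0.
by apply: ge_sup => // _ [a _ <-]; exact: hfg.
Qed.

Lemma unif_dist_ge0 f g : 0 <= unif_dist f g.
Proof.
have [r0|/set0P[_ [a _ _]]] :=
    eqVneq (range (fun a => mdist (f a) (g a))) set0.
  by rewrite /unif_dist r0 sup0.
exact: le_trans (mdist_ge0 _ _) (unif_dist_ge f g a).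
Qed.

Lemma cbfun_eq f g : (forall a, f a = g a) -> f = g.
Proof.
case: f g => [f fc fb] [g gc gb] /= /funext fg; subst g.
by congr Cbfun; exact: Prop_irrelevance.
Qed.

Lemma unif_distxx f : unif_dist f f = 0.
Proof.
apply/eqP; rewrite eq_le unif_dist_ge0 andbT.
by apply: unif_dist_le => // a; rewrite mdistxx.
Qed.

Lemma unif_dist_positivity f g : unif_dist f g = 0 -> f = g.
Proof.
move=> d0; apply: cbfun_eq => a; apply: (@mdist_positivity R X).
by apply/eqP; rewrite eq_le mdist_ge0 andbT -d0 unif_dist_ge.
Qed.

Lemma unif_dist_sym f g : unif_dist f g = unif_dist g f.
Proof.
rewrite /unif_dist; congr sup; congr image; apply/funext => a.
exact: metric_sym.
Qed.

Lemma unif_dist_triangle g f h :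
  unif_dist f h <= unif_dist f g + unif_dist g h.
Proof.
apply: unif_dist_le; first by rewrite addr_ge0 // unif_dist_ge0.
move=> a; apply: le_trans (metric_triangle _ (g a) _) _.
by rewrite lerD // unif_dist_ge.
Qed.

HB.instance Definition _ := gen_eqMixin (cbfun T X).
HB.instance Definition _ := gen_choiceMixin (cbfun T X).
HB.instance Definition _ := isMetric.Build R (cbfun T X)
  unif_distxx unif_dist_positivity unif_dist_sym unif_dist_triangle.

End FunctionSpace.

Section HOperator.
Context {R : realType} {X : metricType R} {I : Type} {m : nat}.
Variables (c : R) (hc : 0 < c < 1) (F : gifs X I m).
Local Notation Om := (Omega hc m I).
Implicit Type g : mpow (cbfun Om X) m.

Definition Hargs g (a : Om) : mpow X m := [ffun j => (g j : cbfun Om X) (shift a j)].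

(* a 0 is the first letter alpha^1 of a. *)
Definition Hmap g (a : Om) : X := F (a 0%N) (Hargs g a).

Lemma Hargs_continuous g : continuous (Hargs g).
Proof.
apply/continuous_mdistP => a e e0.
have /choice[d hd] (j : 'I_m) : exists d : R, 0 < d /\ forall b : Om,
    mdist a b < d -> mdist (Hargs g a j) (Hargs g b j) < e / 2.
  have /continuous_mdistP : continuous
      ((g j : cbfun Om X) \o (fun b : Om => shift b j)).
    move=> b; apply: continuous_comp; first exact: shift_continuous.
    exact: cbfun_continuous.
  have e20 : 0 < e / 2 by rewrite divr_gt0.
  move=> /(_ a _ e20)[d d0 hd]; exists d; split => // b ab.
  by rewrite !ffunE; exact: hd.
exists (\big[Num.min/1]_(j < m) d j).
  by apply: lt_bigmin => // j _; have [] := hd j.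
move=> b ab; apply: (@le_lt_trans _ _ (e / 2)); last first.
  by rewrite ltr_pdivrMr // ltr_pMr // ltr1n.
apply: max_dist_le; first by rewrite ltW // divr_gt0.
move=> j; have [_ hdj] := hd j; apply/ltW/hdj/(lt_le_trans ab).
exact: bigmin_le_cond.
Qed.

Lemma Hmap_continuous g : continuous (Hmap g).
Proof.
apply/continuous_mdistP => a e e0.
have /continuous_mdistP/(_ a _ e0)[d d0 hd] : continuous (F (a 0%N) \o Hargs g).
  move=> b; apply: continuous_comp; first exact: Hargs_continuous.
  exact: gifs_continuous.
exists (Num.min c d); first by rewrite lt_min d0 (c_gt0 (hc := hc)).
move=> b; rewrite lt_min => /andP[abc abd].
suff ab : a 0%N = b 0%N by rewrite /Hmap -ab; exact: hd.
exact: (@Omega_dist_lt_eq _ _ hc).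
Qed.

Lemma Hargs_bounded g : metric_bounded (range (Hargs g)).
Proof.
have /choice[M hM] (j : 'I_m) : exists M : R, forall x y,
    range (g j : cbfun Om X) x -> range (g j : cbfun Om X) y -> mdist x y <= M.
  exact: cbfun_bounded.
exists (\big[Num.max/0]_(j < m) M j) => _ _ [a _ <-] [b _ <-].
apply: max_dist_le; first exact: bigmax_ge_id.
move=> j; apply: le_trans (le_bigmax _ M j); rewrite !ffunE.
by apply: hM; [exists (shift a j)|exists (shift b j)].
Qed.

Lemma Hmap_bounded g : metric_bounded (range (Hmap g)).
Proof.
have [M hM] := gifs_bounded F (Hargs_bounded g).
exists M => _ _ [a _ <-] [b _ <-]; apply: hM.
  by exists (a 0%N) => //; exists (Hargs g a) => //; exists a.
by exists (b 0%N) => //; exists (Hargs g b) => //; exists b.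
Qed.

Definition Hop g : cbfun Om X := Cbfun (@Hmap_continuous g) (Hmap_bounded g).

End HOperator.

Arguments Hop {R X I m c} hc F g.

(* Main.v *)
Require Import Defs.
From mathcomp Require Import all_boot all_order all_algebra.
From mathcomp Require Import all_classical all_reals all_analysis.

Set Implicit Arguments.
Unset Strict Implicit.
Unset Printing Implicit Defensive.

Import Order.TTheory GRing.Theory Num.Theory.

Local Open Scope classical_set_scope.
Local Open Scope ring_scope.

(** A supremum of Lipschitz constants below 1 leaves room for a single real
    number [C] with [0 < C < 1] such that every [F i] is [C]-Lipschitz
    ([uniform_contraction]).  Evaluating [Hop hc F] at [a] applies one of the
    maps [F i] to a tuple whose j-th entry is the j-th function at the shifted
    code [shift a j]; two such tuples, built from [x] and from [y] at the same
    code, are no farther apart than [x] and [y] are uniformly.  Hence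
    [Hop hc F] is [C]-Lipschitz as well ([Hop_lipschitz]), and a map that
    contracts by a factor [C < 1] is Meir-Keeler: [mdist x y < e / C] forces
    the images to be less than [e] apart, and [e / C > e]
    ([lipschitz_meir_keeler]). *)

Lemma lipschitz_meir_keeler (R : realType) (Y : metricType R) (m : nat)
    (f : mpow Y m -> Y) (C : R) : 0 < C < 1 ->
  (forall x y, mdist (f x) (f y) <= C * mdist x y) -> meir_keeler f.
Proof.
move=> /andP[C0 C1] hf e e0; exists (e / C - e).
  by rewrite subr_gt0 ltr_pdivlMr // gtr_pMr.
move=> x y; rewrite addrC subrK ltr_pdivlMr // mulrC => xy.
exact: le_lt_trans (hf x y) xy.
Qed.

Lemma lip_ge0 (R : realType) (Y Z : metricType R) (f : Y -> Z) :
  (0 <= lip f)%E.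
Proof. by apply/ereal_infP => _ [L [L0 _] <-]; rewrite lee_fin. Qed.

(** The strict inequality spares the question whether the infimum defining [lip]
    is attained: a number above it exceeds some admissible constant. *)
Lemma lip_lt_lipschitz (R : realType) (Y Z : metricType R) (f : Y -> Z) (C : R) :
  (lip f < C%:E)%E -> forall x y, mdist (f x) (f y) <= C * mdist x y.
Proof.
move=> /ereal_inf_lt[_ [L [_ hL] <-]]; rewrite lte_fin => /ltW LC x y.
by apply: le_trans (hL x y) _; rewrite ler_wpM2r // mdist_ge0.
Qed.

(** [C] is chosen strictly between the supremum and 1, which makes it positive
    too, because the supremum of a nonempty family of Lipschitz constants is
    nonnegative. *)
Lemma uniform_contraction (R : realType) (Y Z : metricType R) (I : Type)
    (F : I -> Y -> Z) : inhabited I ->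
  (ereal_sup (range (fun i => lip (F i))) < 1)%E ->
  exists2 C : R, 0 < C < 1 &
    forall i x y, mdist (F i x) (F i y) <= C * mdist x y.
Proof.
move=> [i0] S1; set S := ereal_sup _ in S1 *.
have lipS i : (lip (F i) <= S)%E by apply: ereal_sup_ubound; exists i.
have S0 : (0 <= S)%E := le_trans (lip_ge0 (F i0)) (lipS i0).
case: S S0 S1 lipS => [s| |] //; rewrite lee_fin lte_fin => s0 s1 lipS.
have [sC C1] := midf_lt s1.
exists ((s + 1) / 2); first by rewrite C1 (le_lt_trans s0).
by move=> i; apply/lip_lt_lipschitz/(le_lt_trans (lipS i)); rewrite lte_fin.
Qed.

Lemma Hargs_dist_le (R : realType) (X : metricType R) (I : Type) (m : nat)
    (c : R) (hc : 0 < c < 1) (x y : mpow (cbfun (Omega hc m I) X) m)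
    (a : Omega hc m I) :
  mdist (Hargs x a) (Hargs y a) <= mdist x y.
Proof.
apply: max_dist_le; first exact: mdist_ge0.
move=> j; rewrite !ffunE.
exact: le_trans (unif_dist_ge _ _ _) (max_dist_ge x y j).
Qed.

(** At a given code the same map [F (a 0)] acts on both tuples, so a common
    Lipschitz constant passes to the pointwise distances, hence to their
    supremum. *)
Lemma Hop_lipschitz (R : realType) (X : metricType R) (I : Type) (m : nat)
    (c : R) (hc : 0 < c < 1) (F : gifs X I m) (C : R) : 0 <= C ->
  (forall i x y, mdist (F i x) (F i y) <= C * mdist x y) ->
  forall x y, mdist (Hop hc F x) (Hop hc F y) <= C * mdist x y.
Proof.
move=> C0 hF x y; apply: unif_dist_le; first by rewrite mulr_ge0 // mdist_ge0.
move=> a; apply: le_trans (hF _ _ _) _.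
by rewrite ler_wpM2l // Hargs_dist_le.
Qed.

Theorem proposition3p7 (R : realType) (X : metricType R) (I : Type) (m : nat)
    (c : R) (hX : inhabited X) (hI : inhabited I) (hm : (0 < m)%N)
    (hc : 0 < c < 1) (F : gifs X I m)
    (hF : (ereal_sup (range (fun i : I => lip (F i))) < 1)%E) :
  meir_keeler (Hop hc F).
Proof.
have [C C01 hC] := uniform_contraction hI hF.
apply: (lipschitz_meir_keeler C01); apply: Hop_lipschitz => //.
by case/andP: C01 => /ltW.
Qed.
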